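(* Let $\mathcal I\subset\mathbb Z^d$ be a finite frequency set with expansion $K:=\max_{j\in\{1,\dots,d\}}\big(\max_{\mathbf k\in\mathcal I}k_j-\min_{\mathbf l\in\mathcal I}l_j\big)$. Let $\sigma\in(0,1]$, and let $M$ be the smallest prime greater than $\max\!\left(K,\frac{|\mathcal I|^2}{\sigma}\right)$. If the components of $\mathbf z$ are drawn i.i.d. uniformly from $\{1,\dots,M-1\}$, then $\Lambda(\mathbf z,M)$ is a reconstructing rank-1 lattice for $\mathcal I$ with probability at least $1-\sigma$.
   Context: For $M\in\mathbb N$ and $\mathbf z\in\{1,\dots,M-1\}^d$, the rank-1 lattice is $\Lambda(\mathbf z,M)=\{\tfrac jM\mathbf z\bmod\mathbf 1:j\in\{0,\dots,M-1\}\}\subset\mathbb T^d$, with $\mathbb T=\mathbb R/\mathbb Z$. It is called reconstructing for $\mathcal I$ if $\mathbf l\cdot\mathbf z\not\equiv\mathbf k\cdot\mathbf z\pmod M$ for all distinct $\mathbf l,\mathbf k\in\mathcal I$. *)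

(* Defs.v *)
(* MathComp / MathComp-Analysis *)
From HB Require Import structures.
From mathcomp Require Import all_boot all_order all_algebra finmap.
From mathcomp Require Import all_classical all_reals all_analysis.

Set Implicit Arguments.
Unset Strict Implicit.
Unset Printing Implicit Defensive.

Import Order.TTheory GRing.Theory Num.Theory.
Local Open Scope classical_set_scope.
Local Open Scope ring_scope.

(* The neutral element is an entry of the list, so these are the true maximum
   and minimum of a nonempty list (and 0 for the empty list). *)
Definition max_seq (s : seq int) : int := \big[Num.max/head 0 s]_(a <- s) a.
Definition min_seq (s : seq int) : int := \big[Num.min/head 0 s]_(a <- s) a.

(* The outer maximum may start from 0 because each difference max - min is
   nonnegative. *)
Definition expansion (d : nat) (I : {fset 'rV[int]_d}) : int :=
  \big[Num.max/0]_(j < d)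
    (max_seq [seq k 0 j | k : 'rV[int]_d <- I]
     - min_seq [seq l 0 j | l : 'rV[int]_d <- I]).

Definition dotz (d : nat) (k : 'rV[int]_d) (z : 'I_d -> nat) : int :=
  \sum_(i < d) k 0 i * (z i)%:Z.

(* The lattice {(j/M) z mod 1 : 0 <= j < M} enters only through its generating
   data (z, M). *)
Definition reconstructing_rank1_lattice (d : nat) (z : 'I_d -> nat) (M : nat)
    (I : {fset 'rV[int]_d}) : Prop :=
  (forall i : 'I_d, (1 <= z i <= M.-1)%N) /\
  (forall l k : 'rV[int]_d, l \in I -> k \in I -> l <> k ->
     ~ (dotz l z = dotz k z %[mod M%:Z])%Z).

Definition smallest_prime_gt (R : realType) (x : R) (M : nat) : Prop :=
  [/\ prime M, x < M%:R &
      forall q : nat, prime q -> x < q%:R -> (M <= q)%N].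

Definition mutually_independent (disp disp' : measure_display)
    (Omega : measurableType disp) (T' : measurableType disp') (R : realType)
    (P : probability Omega R) (J : finType) (X : J -> {RV P >-> T'}) : Prop :=
  forall (S : {set J}) (A : J -> set T'), (forall j, measurable (A j)) ->
    P (\bigcap_(j in [set j | j \in S]) X j @^-1` A j) =
    (\prod_(j in S) P (X j @^-1` A j))%E.

Definition uniform_on_range (disp : measure_display)
    (Omega : measurableType disp) (R : realType) (P : probability Omega R)
    (X : {RV P >-> nat}) (n : nat) : Prop :=
  forall m : nat, distribution P X [set m] =
    (if (1 <= m <= n)%N then n%:R^-1 else 0)%:E.

(* Main.v *)
(* If l <> k differ in coordinate i, then 0 < |l_i - k_i| <= K < M, so l_i - k_i
   is invertible modulo the prime M: once the other coordinates of z are fixed,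
   at most one z_i makes l.z and k.z congruent. Thus each ordered pair (l, k)
   collides for a fraction at most 1/(M-1) of all z, and a union bound over the
   n(n-1) ordered pairs suffices because n(n-1) <= n^2 - 1 <= sigma (M-1)
   when n = |I| >= 1. *)
Require Import Defs.
From HB Require Import structures.
From mathcomp Require Import all_boot all_order all_algebra finmap.
From mathcomp Require Import all_classical all_reals all_analysis.
From mathcomp Require Import zify lra.

Set Implicit Arguments.
Unset Strict Implicit.
Unset Printing Implicit Defensive.

Import Order.TTheory GRing.Theory Num.Theory.
Local Open Scope classical_set_scope.
Local Open Scope ring_scope.

Lemma le_max_seq (s : seq int) (x : int) : x \in s -> x <= max_seq s.
Proof. by move=> xs; rewrite /max_seq; exact: (le_bigmax_seq _ x). Qed.

Lemma ge_min_seq (s : seq int) (x : int) : x \in s -> min_seq s <= x.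
Proof. by move=> xs; rewrite /min_seq; exact: (ge_bigmin_seq _ x). Qed.

Lemma coord_sub_le_expansion (d : nat) (I : {fset 'rV[int]_d})
    (l k : 'rV[int]_d) (i : 'I_d) :
  l \in I -> k \in I -> l 0 i - k 0 i <= expansion I.
Proof.
move=> lI kI; rewrite /expansion.
apply: le_trans (le_bigmax _ _ i); apply: lerB.
  by apply: le_max_seq; apply/mapP; exists l.
by apply: ge_min_seq; apply/mapP; exists k.
Qed.

Lemma coord_absz_lt (d : nat) (I : {fset 'rV[int]_d}) (M : nat)
    (l k : 'rV[int]_d) (i : 'I_d) :
  expansion I < M%:Z -> l \in I -> k \in I -> (`|(l 0 i - k 0 i)%R| < M)%N.
Proof.
move=> KM lI kI; rewrite -ltz_nat abszE ltr_norml; apply/andP; split.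
  by rewrite ltrNl opprB (le_lt_trans _ KM)// coord_sub_le_expansion.
by rewrite (le_lt_trans _ KM)// coord_sub_le_expansion.
Qed.

(* The point f of the grid {1, ..., N}^d, whose coordinates are stored shifted
   by one so that they range over 'I_N. *)
Definition grid_point (d N : nat) (f : {ffun 'I_d -> 'I_N}) (i : 'I_d) : nat :=
  (f i).+1.

Definition collisions (d N M : nat) (l k : 'rV[int]_d) :
    {set {ffun 'I_d -> 'I_N}} :=
  [set f | (dotz l (grid_point f) == dotz k (grid_point f) %[mod M%:Z])%Z]%SET.

(** Subtracting the two congruences cancels every coordinate but [i] and leaves [M] dividing
    [(l_i - k_i) * (f_i - g_i)]. The prime [M] divides one factor; the first is nonzero and smaller
    than [M] in absolute value, and the second is smaller than [N < M], hence zero. *)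
Lemma collisions_coord_inj (d N M : nat) (l k : 'rV[int]_d) (i : 'I_d)
    (f g : {ffun 'I_d -> 'I_N}) :
  prime M -> (N < M)%N -> l 0 i != k 0 i -> (`|(l 0 i - k 0 i)%R| < M)%N ->
  f \in collisions N M l k -> g \in collisions N M l k ->
  (forall j, j != i -> f j = g j) -> f i = g i.
Proof.
move=> Mp NM lki lkM; rewrite !inE !eqz_mod_dvd => Mf Mg fg.
have := rpredB Mf Mg; rewrite /dotz -!sumrB (bigD1 i)//= big1 ?addr0; last first.
  by move=> j ji; rewrite /grid_point fg// subrr.
rewrite -!mulrBl -mulrBr unfold_in /= abszM Euclid_dvdM// => /orP[].
  by move/dvdn_leq; rewrite absz_gt0 subr_eq0 => /(_ lki); rewrite leqNgt lkM.
move=> Mfg; apply/val_inj/eqP; move: Mfg; apply: contraTT => /= fgi.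
rewrite gtnNdvd//; first by rewrite absz_gt0 subr_eq0 eqz_nat eqSS.
have := ltn_ord (f i); have := ltn_ord (g i).
rewrite /grid_point; lia.
Qed.

Lemma card_collisions (d N M : nat) (l k : 'rV[int]_d) (i : 'I_d) :
  prime M -> (N < M)%N -> l 0 i != k 0 i -> (`|(l 0 i - k 0 i)%R| < M)%N ->
  (#|collisions N M l k| * N <= #|{ffun 'I_d -> 'I_N}|)%N.
Proof.
move=> Mp NM lki lkM.
(* Overwriting coordinate [i] of a collision by an arbitrary value is injective: the result shows
   the new value and all other coordinates, and these determine the old coordinate [i] of a
   collision. *)
pose h (p : {ffun 'I_d -> 'I_N} * 'I_N) : {ffun 'I_d -> 'I_N} :=
  [ffun j => if j == i then p.2 else p.1 j].
have <- : #|finset.setX (collisions N M l k) [set: 'I_N]%SET|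
          = (#|collisions N M l k| * N)%N.
  by rewrite cardsX cardsT card_ord.
apply: (@leq_card_in _ _ h) => -[f a] [g b] /=.
rewrite !inE !andbT /= => fB gB /ffunP fg.
have ab : a = b by have := fg i; rewrite !ffunE eqxx.
have off j : j != i -> f j = g j.
  by move=> ji; have := fg j; rewrite !ffunE (negbTE ji).
congr pair => //; apply/ffunP => j.
have [->|] := eqVneq j i; last exact: off.
by apply: (collisions_coord_inj Mp NM lki lkM) => //; rewrite inE.
Qed.

Lemma leq_card_bigcup (T J : finType) (Q : pred J) (F : J -> {set T}) :
  (#|\bigcup_(j | Q j) F j|%SET <= \sum_(j | Q j) #|F j|)%N.
Proof.
elim/big_ind2: _ => [|A m B n Am Bn|//]; first by rewrite cards0.
by rewrite (leq_trans (leq_card_setU _ _))// leq_add.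
Qed.

Definition reconstructing_grid (d N M : nat) (I : {fset 'rV[int]_d}) :
    {set {ffun 'I_d -> 'I_N}} :=
  [set f | [forall l : I, forall k : I,
     (l != k) ==> (f \notin collisions N M (val l) (val k))]]%SET.

(** Union bound over ordered pairs of distinct frequencies, kept in natural numbers by multiplying
    through by [N] instead of dividing. *)
Lemma card_reconstructing_grid (d N M : nat) (I : {fset 'rV[int]_d}) :
  prime M -> (N < M)%N -> expansion I < M%:Z ->
  (#|{ffun 'I_d -> 'I_N}| * N <= #|reconstructing_grid N M I| * N +
     #|` I| * #|` I|.-1 * #|{ffun 'I_d -> 'I_N}|)%N.
Proof.
move=> Mp NM KM; set T := #|{ffun _}|.
have sub : [set: {ffun 'I_d -> 'I_N}]%SET \subset
    (reconstructing_grid N M I :|: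
     \bigcup_(l : I) \bigcup_(k : I | k != l)
        collisions N M (val l) (val k))%SET.
  apply/fintype.subsetP => f _; rewrite finset.in_setU orbC.
  rewrite -implyNb; apply/implyP => nf.
  rewrite inE; apply/forallP => l; apply/forallP => k; apply/implyP => lk.
  apply: contra nf => fB; apply/finset.bigcupP; exists l => //.
  by apply/finset.bigcupP; exists k; rewrite // eq_sym.
have cardU : (T <= #|reconstructing_grid N M I| +
    \sum_(l : I) \sum_(k : I | k != l) #|collisions N M (val l) (val k)|)%N.
  rewrite /T -cardsT (leq_trans (subset_leq_card sub))//.
  rewrite (leq_trans (leq_card_setU _ _))// leq_add2l.
  rewrite (leq_trans (leq_card_bigcup _ _))// leq_sum// => l _.
  exact: leq_card_bigcup.
rewrite (leq_trans (leq_mul cardU (leqnn N)))// mulnDl leq_add2l big_distrl/=.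
rewrite cardfE -mulnA -sum_nat_const leq_sum// => l _.
(* For fixed [l], the factor [|I| - 1] counts the [k] different from [l], so the bound can be
   compared term by term. *)
rewrite -(cardC1 l) -sum_nat_const big_distrl/= leq_sum// => k kl.
have /eqP/rowP : val l != val k by rewrite (inj_eq val_inj) eq_sym.
move=> /existsNP[i /eqP lki]; apply: (card_collisions Mp NM lki).
by apply: coord_absz_lt KM _ _; exact: valP.
Qed.

(** The range condition on the generating vector makes each of its values a point of the finite
    grid, so the event splits according to which good grid point is hit. *)
Lemma reconstructing_cover (d M : nat) (I : {fset 'rV[int]_d})
    (Omega : Type) (z : 'I_d -> Omega -> nat) :
  [set w | reconstructing_rank1_lattice (fun i => z i w) M I] =
  \bigcup_(f in [set` reconstructing_grid M.-1 M I])
     \bigcap_(j in [set: 'I_d]) z j @^-1` [set grid_point f j].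
Proof.
have collP l k (f : {ffun 'I_d -> 'I_M.-1}) w :
    (forall j, z j w = grid_point f j) ->
    (f \in collisions M.-1 M l k) =
    (dotz l (fun i => z i w) == dotz k (fun i => z i w) %[mod M%:Z])%Z.
  move=> zf; rewrite inE.
  have -> // : grid_point f = (fun i => z i w) by apply/funext => j; rewrite zf.
apply/seteqP; split=> [w [zM recI]|w [f /= + zf]].
  have zlt j : ((z j w).-1 < M.-1)%N by have /andP[] := zM j; case: (z j w).
  pose f := [ffun j => Ordinal (zlt j)].
  have zf j : z j w = grid_point f j.
    by rewrite /grid_point ffunE /= prednK//; have /andP[] := zM j.
  exists f; last by move=> j _ /=; exact: zf.
  rewrite /= inE; apply/forallP => l; apply/forallP => k; apply/implyP => lk.
  rewrite (collP _ _ _ w)//; apply/eqP; apply: recI; try exact: valP.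
  by move/val_inj/eqP; apply/negP.
have {}zf j : z j w = grid_point f j by exact: zf.
rewrite inE => /forallP recf; split=> [i|l k lI kI lk].
  by rewrite zf /grid_point /= ltn_ord.
move: (recf [` lI]%fset) => /forallP/(_ [` kI]%fset)/implyP.
have -> : [` lI]%fset != [` kI]%fset by apply/eqP => -[].
by rewrite (collP _ _ _ w)// => /(_ isT)/eqP.
Qed.

Lemma probability_grid_point (R : realType) (d N : nat)
    (disp : measure_display) (Omega : measurableType disp)
    (P : probability Omega R) (z : 'I_d -> {RV P >-> nat})
    (f : {ffun 'I_d -> 'I_N}) :
  mutually_independent z -> (forall i, uniform_on_range (z i) N) ->
  P (\bigcap_(j in [set: 'I_d]) z j @^-1` [set grid_point f j]) =
  ((#|{ffun 'I_d -> 'I_N}|%:R)^-1)%:E.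
Proof.
move=> indep unif.
have := indep [set: 'I_d]%SET (fun j => [set grid_point f j]) (fun=> Logic.I).
have -> : [set j | j \in [set: 'I_d]%SET] = [set: 'I_d].
  by apply/seteqP; split => j //= _; rewrite inE.
move=> ->; rewrite (eq_bigr (fun=> (N%:R^-1)%:E)); last first.
  by move=> j _; have := unif j (grid_point f j); rewrite /grid_point /= ltn_ord.
(* The product of [d] factors [1/N] is the inverse of the grid size [N^d]. *)
by rewrite prodEFin prodr_const cardsT card_ord card_ffun !card_ord natrX exprVn.
Qed.

Lemma probability_reconstructing (R : realType) (d M : nat)
    (I : {fset 'rV[int]_d}) (disp : measure_display)
    (Omega : measurableType disp) (P : probability Omega R)
    (z : 'I_d -> {RV P >-> nat}) :
  mutually_independent z -> (forall i, uniform_on_range (z i) M.-1) ->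
  P [set w | reconstructing_rank1_lattice (fun i => z i w) M I] =
  (#|reconstructing_grid M.-1 M I|%:R / #|{ffun 'I_d -> 'I_M.-1}|%:R)%:E.
Proof.
move=> indep unif; rewrite reconstructing_cover measure_fin_bigcup//.
- rewrite (eq_fsbigr (fun=> ((#|{ffun 'I_d -> 'I_M.-1}|%:R)^-1)%:E)); last first.
    by move=> f _; exact: probability_grid_point.
  have -> : [set` reconstructing_grid M.-1 M I] =
            [set` enum (reconstructing_grid M.-1 M I)].
    by apply/seteqP; split => f /=; rewrite mem_enum.
  rewrite -fsbig_seq ?enum_uniq// sumEFin big_const_seq count_predT -cardE.
  by rewrite iter_addr_0 mulr_natl.
(* The events are disjoint because the value of [z] at [w] determines the grid point. *)
- apply/trivIsetP => f g _ _ fg; apply/seteqP; split => // w [/= zf zg].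
  move/eqP: fg; apply; apply/ffunP => j; apply/val_inj.
  by have := zf j Logic.I; rewrite /= (zg j Logic.I) => -[].
- move=> f _; apply: fin_bigcap_measurable => // j _.
  by rewrite -[X in measurable X]setTI; exact: measurable_funP.
Qed.

Theorem lemma4 (R : realType) (d : nat) (I : {fset 'rV[int]_d})
    (sigma : R) (M : nat)
    (disp : measure_display) (Omega : measurableType disp)
    (P : probability Omega R) (z : 'I_d -> {RV P >-> nat}) :
  0 < sigma <= 1 ->
  smallest_prime_gt
    (Num.max ((expansion I)%:~R : R) ((#|` I| ^ 2)%N%:R / sigma)) M ->
  mutually_independent z ->
  (forall i : 'I_d, uniform_on_range (z i) M.-1) ->
  ((1 - sigma)%:E <=
   P [set w | reconstructing_rank1_lattice (fun i => z i w) M I])%E.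
Proof.
move=> /andP[sigma0 sigma1] [Mp + _] indep unif.
rewrite gt_max => /andP[KM nM].
have N0 : (0 < M.-1)%N by case: M Mp {KM nM unif} => [|[|]].
have MS : M = M.-1.+1 by rewrite prednK// prime_gt0.
rewrite probability_reconstructing// lee_fin.
have NM : (M.-1 < M)%N by rewrite {2}MS.
have KM' : expansion I < M%:Z by rewrite -(ltr_int R).
have := card_reconstructing_grid Mp NM KM'.
set T := #|{ffun _}|; set G := #|_|; set n := #|` I| => TG.
have T0 : (0 < T)%N by rewrite /T card_ffun !card_ord expn_gt0 N0.
rewrite ler_pdivlMr ?ltr0n//.
have pairs : (n * n.-1)%:R <= sigma * M.-1%:R.
  have [->|n0] := posnP n; first by rewrite mulr_ge0// ltW.
  (* The spare 1, available since [n >= 1], absorbs the loss [sigma <= 1] in passing from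
     [n^2 < sigma * M] to a bound by [sigma * (M - 1)]. *)
  have : (n * n.-1 + 1 <= n ^ 2)%N by nia.
  move: nM; rewrite ltr_pdivrMr// {1}MS -(ler_nat R) natrD [M.-1.+1%:R]mulrSr.
  rewrite -/n; lra.
move: TG; rewrite -(ler_nat R) natrD (natrM _ T) (natrM _ G) (natrM _ (n * _)) => TG.
have N0' : 0 < M.-1%:R :> R by rewrite ltr0n.
(* After multiplying by [M - 1], the goal is [T * (M - 1) <= G * (M - 1) + sigma * T * (M - 1)],
   which follows from the count [TG] and [pairs]. *)
rewrite -(ler_pM2r N0') mulrBl mul1r mulrBl lerBlDr (le_trans TG)//.
by rewrite lerD2l mulrAC ler_pM2r// ltr0n.
Qed.
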